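(* Let $G$ be a simple connected graph with $n$ nodes and $m$ edges, let $q$ be a positive integer, and let $R_q(G)$ be its $q$-triangulation graph with node set $\tilde V=V\cup V'$. Let $r_{ij}$ and $\tilde r_{ij}$ denote resistance distances in $G$ and $R_q(G)$, respectively. Then: 1) for $i,j\in V$, $\tilde r_{ij}=\frac{2}{q+2}r_{ij}$; 2) for $i\in V'$, $j\in V$ and $\tilde\Gamma(i)=\{s,t\}$, $$\tilde r_{ij}=\frac12+\frac{2r_{sj}+2r_{tj}-r_{st}}{2(q+2)};$$ 3) for $i,j\in V'$ with $i\neq j$, $\tilde\Gamma(i)=\{s,t\}$ and $\tilde\Gamma(j)=\{u,v\}$, $$\tilde r_{ij}=1+\frac{r_{su}+r_{tu}+r_{sv}+r_{tv}-r_{uv}-r_{st}}{2(q+2)}.$$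
   Context: For a positive integer $q$, the $q$-triangulation graph $R_q(G)$ is obtained from $G$ by keeping all nodes and edges of $G$ and adding, for each edge $uv$ of $G$, $q$ disjoint paths of length $2$: $ux_1v,\dots,ux_qv$, where $x_1,\dots,x_q$ are new nodes. $V$ is the set of old nodes (those of $G$) and $V'$ the set of new nodes; $\tilde\Gamma(x)$ is the set of neighbors of $x$ in $R_q(G)$. The resistance distance between two nodes of a simple connected graph is the effective resistance between them in the electrical network obtained by replacing every edge by a unit resistor (with $r_{ii}=0$). *)

(* Defs.v *)
From mathcomp Require Import all_boot all_order all_algebra.
From mathcomp Require Import boolp classical_sets.

Set Implicit Arguments.
Unset Strict Implicit.
Unset Printing Implicit Defensive.

Import Order.TTheory GRing.Theory Num.Theory.
Local Open Scope ring_scope.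

Record sgraph := SGraph {
  node :> finType;
  adj : rel node;
  adj_sym : symmetric adj;
  adj_irrefl : irreflexive adj }.

Definition connected_graph (G : sgraph) : Prop :=
  forall x y : G, connect (@adj G) x y.

Definition neighbors (G : sgraph) (x : G) : {set G} := [set y | adj x y].

(* Edges are unordered pairs, so that uv and vu carry the same new nodes. *)
Definition edges (G : sgraph) : {set {set G}} :=
  [set [set u; v] | u in G, v in neighbors u].

Definition edge (G : sgraph) : finType := {E : {set G} | E \in edges G}.

Section Triangulation.
Variables (G : sgraph) (q : nat).

(* [inl x] is the old node x; [inr (uv, k)] is the middle node of the k-th
   path of length 2 added between u and v. *)
Definition tri_node : finType := (G + edge G * 'I_q)%type.

Definition tri_adj (a b : tri_node) : bool :=
  match a, b with
  | inl u, inl v => adj u v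
  | inl u, inr (E, _) => u \in val E
  | inr (E, _), inl v => v \in val E
  | inr _, inr _ => false
  end.

Lemma tri_adj_sym : symmetric tri_adj.
Proof. by move=> [u|[E k]] [v|[F l]] //=; rewrite adj_sym. Qed.

Lemma tri_adj_irrefl : irreflexive tri_adj.
Proof. by move=> [u|[E k]] //=; rewrite adj_irrefl. Qed.

Definition triangulation : sgraph := SGraph tri_adj_sym tri_adj_irrefl.

End Triangulation.

Section Resistance.
Variables (R : realFieldType) (G : sgraph).

(* Each edge being a unit resistor, the current from x to a neighbor y is
   p x - p y; Kirchhoff's current law then says that a unit current enters
   the network at i and leaves it at j. *)
Definition unit_current_potential (i j : G) (p : G -> R) : Prop :=
  forall x : G,
    \sum_(y in neighbors x) (p x - p y) = (x == i)%:R - (x == j)%:R.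

Definition is_resistance (i j : G) (c : R) : Prop :=
  exists2 p : G -> R, unit_current_potential i j p & c = p i - p j.

(* The value is well defined on connected graphs: see resistanceP and
   is_resistance_unique. The default value 0 only matters for nodes in
   different components. *)
Definition resistance (i j : G) : R := xget 0 (is_resistance i j).

Let lap (p : G -> R) (x : G) : R := \sum_(y in neighbors x) (p x - p y).

Let lap_dot (p p' : G -> R) : \sum_x p' x * lap p x =
  2^-1 * \sum_x \sum_y (adj x y)%:R * ((p x - p y) * (p' x - p' y)).
Proof.
have E1 : \sum_x p' x * lap p x =
    \sum_x \sum_y (adj x y)%:R * ((p x - p y) * p' x).
  apply: eq_bigr => x _; rewrite mulr_sumr big_mkcond; apply: eq_bigr => y _.
  by rewrite inE; case: (adj x y); rewrite ?mul0r// mul1r mulrC.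
have E2 : \sum_x p' x * lap p x =
    - \sum_x \sum_y (adj x y)%:R * ((p x - p y) * p' y).
  rewrite E1 exchange_big -sumrN; apply: eq_bigr => x _; rewrite -sumrN.
  apply: eq_bigr => y _.
  by rewrite adj_sym -mulrN -mulNr opprB.
apply: (@mulfI _ 2); first by rewrite pnatr_eq0.
rewrite mulVKf ?pnatr_eq0// mulr_natl mulr2n {1}E1 E2 -sumrB.
apply: eq_bigr => x _; rewrite -sumrB; apply: eq_bigr => y _.
by rewrite -mulrBr -mulrBr.
Qed.

Let dot_delta (i j : G) (f : G -> R) :
  \sum_x f x * ((x == i)%:R - (x == j)%:R) = f i - f j.
Proof.
have D k : \sum_x f x * (x == k)%:R = f k.
  rewrite (bigD1 k)//= eqxx mulr1 big1 ?addr0// => x /negPf->.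
  by rewrite mulr0.
by under eq_bigr do rewrite mulrBr; rewrite sumrB !D.
Qed.

Lemma is_resistance_unique (i j : G) (c d : R) :
  is_resistance i j c -> is_resistance i j d -> c = d.
Proof.
move=> [p Hp ->] [p' Hp' ->].
have -> : p i - p j = \sum_x p x * lap p' x.
  by rewrite -dot_delta; apply: eq_bigr => x _; rewrite /lap Hp'.
have -> : p' i - p' j = \sum_x p' x * lap p x.
  by rewrite -dot_delta; apply: eq_bigr => x _; rewrite /lap Hp.
rewrite !lap_dot; congr (_ * _); apply: eq_bigr => x _; apply: eq_bigr => y _.
by congr (_ * _); rewrite mulrC.
Qed.

Let harmonic_const (p : G -> R) : connected_graph G ->
  (forall x, lap p x = 0) -> forall x y, p x = p y.
Proof.
move=> Gc Hp x y.
have ge0 u v : 0 <= (adj u v)%:R * ((p u - p v) * (p u - p v)) :> R.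
  by rewrite mulr_ge0 ?ler0n// -expr2 sqr_ge0.
have /eqP S0 : \sum_u \sum_v (adj u v)%:R * ((p u - p v) * (p u - p v)) = 0 :> R.
  have := lap_dot p p; rewrite big1 => [|u _]; last by rewrite Hp mulr0.
  by move/esym/eqP; rewrite mulf_eq0 invr_eq0 pnatr_eq0/= => /eqP.
have step u v : adj u v -> p u = p v.
  move=> uv; move: S0; rewrite psumr_eq0; last by move=> ? _; apply: sumr_ge0.
  move/allP/(_ u (mem_index_enum _)) => /=; rewrite psumr_eq0//.
  move/allP/(_ v (mem_index_enum _)) => /=.
  by rewrite uv mul1r mulf_eq0 orbb subr_eq0 => /eqP.
case/connectP: (Gc x y) => s; elim: s x => [|z s IH] x /=; first by move=> _ ->.
by case/andP=> xz sz ys; rewrite (step _ _ xz) (IH _ sz ys).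
Qed.

Lemma resistanceP (i j : G) : connected_graph G ->
  is_resistance i j (resistance i j).
Proof.
move=> Gc; rewrite /resistance; case: xgetP => [c ->//|no]; exfalso.
pose L : 'M[R]_#|G| := \matrix_(a, b)
  ((a == b)%:R * #|neighbors (enum_val a)|%:R
    - (adj (enum_val a) (enum_val b))%:R).
pose b : 'rV[R]_#|G| :=
  \row_a ((enum_val a == i)%:R - (enum_val a == j)%:R).
have reidx (F : G -> R) : \sum_(a < #|G|) F (enum_val a) = \sum_x F x.
  by rewrite [RHS](reindex (@enum_val G predT))//; apply: onW_bij; apply: enum_val_bij.
have LE (f : G -> R) (x : G) :
    \sum_a L (enum_rank x) a * f (enum_val a) = lap f x.
  rewrite /lap sumrB sumr_const.
  under eq_bigr do rewrite mxE mulrBl enum_rankK.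
  rewrite sumrB; congr (_ - _).
    rewrite (bigD1 (enum_rank x))//= eqxx mul1r enum_rankK mulr_natl.
    rewrite big1 ?addr0// => a; rewrite eq_sym => /negPf->.
    by rewrite !mul0r.
  rewrite (reidx (fun y => (adj x y)%:R * f y)) [RHS]big_mkcond.
  apply: eq_bigr => y _; rewrite inE.
  by case: (adj x y); rewrite ?mul0r ?mul1r.
have Lsym a c : L a c = L c a.
  rewrite !mxE adj_sym eq_sym; case: eqVneq => [->//|_]; by rewrite !mul0r.
have : (b <= L)%MS.
  rewrite submxE; apply/eqP/rowP => k; rewrite [LHS]mxE [RHS]mxE.
  pose f (x : G) : R := cokermx L (enum_rank x) k.
  have fh x : lap f x = 0.
    rewrite -LE; have := congr1 (fun M : 'M_#|G| => M (enum_rank x) k) (mulmx_coker L).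
    rewrite [LHS]mxE [RHS]mxE => H; rewrite -[RHS]H; apply: eq_bigr => a _.
    by rewrite /f enum_valK.
  transitivity (\sum_x f x * ((x == i)%:R - (x == j)%:R)); last first.
    by rewrite dot_delta (harmonic_const Gc fh i j) subrr.
  rewrite -reidx; apply: eq_bigr => a _.
  by rewrite mxE mulrC /f enum_valK.
case/submxP => w Hw; pose p x := w 0 (enum_rank x).
apply: (no (p i - p j)); exists p => // x.
have -> : (x == i)%:R - (x == j)%:R = b 0 (enum_rank x) by rewrite mxE enum_rankK.
rewrite -/(lap p x) -LE Hw [RHS]mxE; apply: eq_bigr => a _.
by rewrite /p enum_valK mulrC Lsym.
Qed.

End Resistance.

(* Main.v *)
Require Import Defs.
From mathcomp Require Import all_boot all_order all_algebra.
From mathcomp Require Import boolp.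
From mathcomp Require Import ring.
From mathcomp Require classical_sets.

(** The three formulas are one formula, [triangulation_resistance], evaluated
    on old and new nodes.

    On any connected network, currents mu injected at the nodes (with total 0)
    dissipate the energy
      sum_x mu(x) p(x) = - 1/2 sum_(x, y) mu(x) mu(y) r(x, y),
    where p is any potential that they create ([energy_resistance]); this
    follows from the reciprocity of resistor networks, i.e. from the symmetry
    of the Laplacian.

    In the triangulation graph, a current injected at the middle node of a
    path u - x - v leaves it, by symmetry, in equal halves through its feet u
    and v, while a current from u to v sees, besides the edge uv, q parallel
    paths of resistance 2. So for the old nodes the network is G with all
    resistances multiplied by 2 / (q + 2), and with the current of a new node
    injected half at each of its feet. Conversely, rescaling a potential of G
    with these injected currents, and raising each new node from the average
    of its two feet by half the current injected there (its two unit edges are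
    in parallel), gives a potential of the triangulation graph
    ([laplacian_lift]).

    A resistance in the triangulation graph is the energy of a unit current:
    1/2 for each of its two ends that is new, plus 2 / (q + 2) times the energy
    in G of the corresponding halved currents. By the energy formula the latter
    is a combination of averages of resistances of G over feet. *)

Set Implicit Arguments.
Unset Strict Implicit.
Unset Printing Implicit Defensive.

Import Order.TTheory GRing.Theory Num.Theory.
Local Open Scope ring_scope.

(** * Potentials and energy in a connected network *)

Definition laplacian (R : realFieldType) (G : sgraph) (p : G -> R) (x : G) : R :=
  \sum_(y in neighbors x) (p x - p y).

Lemma sum_delta (R : realFieldType) (T : finType) (i : T) (f : T -> R) :
  \sum_x (x == i)%:R * f x = f i.
Proof.
rewrite (bigD1 i) //= eqxx mul1r big1 ?addr0 // => x /negPf ->.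
by rewrite mul0r.
Qed.

Lemma sum_dipole (R : realFieldType) (T : finType) (i j : T) (f : T -> R) :
  \sum_x ((x == i)%:R - (x == j)%:R) * f x = f i - f j.
Proof. by under eq_bigr do rewrite mulrBl; rewrite sumrB !sum_delta. Qed.

Lemma sum_pair (R : realFieldType) (T : finType) (s t : T) (f : T -> R) :
  s != t -> \sum_(x in [set s; t]) f x = f s + f t.
Proof. by move=> st; rewrite big_setU1 ?inE // big_set1. Qed.

Section Network.
Variables (R : realFieldType) (G : sgraph).
Implicit Types (p f mu : G -> R) (x y k l i j : G).
Local Notation r := (@resistance R G).

Lemma laplacian_self_adjoint f p :
  \sum_x f x * laplacian p x = \sum_x laplacian f x * p x.
Proof.
have E f' p' : \sum_x f' x * laplacian p' x =
    \sum_x \sum_y (adj x y)%:R * (f' x * p' x)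
    - \sum_x \sum_y (adj x y)%:R * (f' x * p' y).
  rewrite -sumrB; apply: eq_bigr => x _; rewrite mulr_sumr big_mkcond -sumrB.
  apply: eq_bigr => y _; rewrite inE.
  by case: (adj x y); rewrite ?mul0r ?subrr // !mul1r mulrBr.
under [RHS]eq_bigr do rewrite mulrC.
rewrite !E; congr (_ - _).
  by apply: eq_bigr => x _; apply: eq_bigr => y _; rewrite [f x * _]mulrC.
rewrite exchange_big; apply: eq_bigr => x _; apply: eq_bigr => y _.
by rewrite adj_sym [f y * _]mulrC.
Qed.

Lemma sum_laplacian p : \sum_x laplacian p x = 0.
Proof.
have := laplacian_self_adjoint (fun=> 1) p.
under eq_bigr do rewrite mul1r.
move=> ->; apply: big1 => x _.
by rewrite [laplacian _ _]big1 ?mul0r // => y _; rewrite subrr.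
Qed.

Lemma resistance_eq i j p :
  unit_current_potential i j p -> r i j = p i - p j.
Proof.
move=> Hp; have Hr : is_resistance i j (p i - p j) by exists p.
rewrite /resistance; case: classical_sets.xgetP => [c _ Hc|no]; last first.
  by case: (no _ Hr).
exact: is_resistance_unique Hc Hr.
Qed.

Hypothesis G_connected : connected_graph G.

Lemma unit_current_potential_exists i j :
  exists p : G -> R, unit_current_potential i j p.
Proof. by case: (resistanceP R i j G_connected) => p Hp _; exists p. Qed.

Lemma resistance_sym i j : r i j = r j i.
Proof.
have [p Hp] := unit_current_potential_exists i j.
rewrite (resistance_eq Hp) (@resistance_eq _ _ (fun x => - p x)); first by ring.
move=> x; rewrite -opprB -Hp -sumrN; apply: eq_bigr => y _; ring.
Qed.

Lemma resistance_refl i : r i i = 0.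
Proof.
by have [p /resistance_eq ->] := unit_current_potential_exists i i; rewrite subrr.
Qed.

(** Resistances alone determine every potential. If g is the potential of a
    unit current from k to l and u that of one from x to l, then u - g is a
    potential for x and k, and reciprocity exchanges u and g; so r x l - r x k
    is 2 g(x) up to a constant independent of x. That constant is lost in the
    sum, as the injected currents have total 0, and what remains is
    sum_x (laplacian p x) g(x), which is p(k) - p(l) by self-adjointness. *)
Lemma potential_difference p k l :
  p k - p l = 2^-1 * \sum_x laplacian p x * (r x l - r x k).
Proof.
have [g Hg] := unit_current_potential_exists k l.
have rE x : r x l - r x k = 2 * g x - (g k + g l).
  have [u Hu] := unit_current_potential_exists x l.
  have Hug : unit_current_potential x k (fun y => u y - g y).
    move=> y; transitivity (laplacian u y - laplacian g y).
      by rewrite /laplacian -sumrB; apply: eq_bigr => z _; ring.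
    by rewrite [laplacian u y]Hu [laplacian g y]Hg; ring.
  rewrite (resistance_eq Hu) (resistance_eq Hug).
  have reciprocity : u k - u l = g x - g l.
    rewrite -!sum_dipole; under eq_bigr do rewrite -Hg.
    under [RHS]eq_bigr do rewrite -Hu.
    by rewrite -laplacian_self_adjoint; apply: eq_bigr => y _; rewrite mulrC.
  have -> : u k = u l + (g x - g l) by rewrite -reciprocity; ring.
  by ring.
under eq_bigr do rewrite rE mulrBr mulrCA.
rewrite sumrB -mulr_suml sum_laplacian mul0r subr0 -mulr_sumr.
rewrite mulKf ?pnatr_eq0 // -laplacian_self_adjoint -sum_dipole.
by apply: eq_bigr => x _; rewrite -Hg mulrC.
Qed.

(** Potentials are defined up to a constant, so p can be replaced by its
    difference with the value at a fixed node l; [potential_difference] then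
    gives a double sum in which the terms r y l cancel. *)
Lemma energy_resistance p :
  \sum_x laplacian p x * p x =
  - 2^-1 * \sum_x laplacian p x * \sum_y laplacian p y * r x y.
Proof.
have [l _|G0] := pickP (@predT G); last first.
  by rewrite !big1 ?mulr0 // => x; have := G0 x.
transitivity (\sum_x laplacian p x * (p x - p l)).
  under [RHS]eq_bigr do rewrite mulrBr.
  by rewrite sumrB -mulr_suml sum_laplacian mul0r subr0.
under eq_bigr do rewrite potential_difference mulrCA.
rewrite -mulr_sumr mulNr -mulrN; congr (_ * _).
transitivity (\sum_x (laplacian p x * (\sum_y laplacian p y * r y l)
   - laplacian p x * \sum_y laplacian p y * r x y)).
  apply: eq_bigr => x _; rewrite -mulrBr -sumrB; congr (_ * _).
  by apply: eq_bigr => y _; rewrite mulrBr (resistance_sym y x).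
by rewrite sumrB -mulr_suml sum_laplacian mul0r sub0r.
Qed.

(** Superposition: send each injected current mu x from x to a common node z;
    since they add up to 0, nothing leaves the network at z. *)
Lemma poisson_solvable mu :
  \sum_x mu x = 0 -> exists p, forall x, laplacian p x = mu x.
Proof.
move=> mu0; have [z _|G0] := pickP (@predT G); last first.
  by exists mu => x; have := G0 x.
have [u Hu] := choice (fun x => unit_current_potential_exists x z).
exists (fun y => \sum_x mu x * u x y) => y.
transitivity (\sum_x mu x * laplacian (u x) y).
  rewrite [LHS]/laplacian; under eq_bigr do rewrite -sumrB.
  rewrite exchange_big; apply: eq_bigr => x _; rewrite mulr_sumr.
  by apply: eq_bigr => w _; rewrite mulrBr.
under eq_bigr do rewrite [laplacian _ _]Hu mulrBr.
rewrite sumrB -mulr_suml mu0 mul0r subr0 -[RHS](sum_delta y mu).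
by apply: eq_bigr => x _; rewrite mulrC eq_sym.
Qed.

End Network.

(** * Potentials in the triangulation graph *)

Section Triangulation.
Variables (R : realFieldType) (G : sgraph) (q : nat).
Local Notation RqG := (triangulation G q).

Definition new_node (a : RqG) : bool := if a is inr _ then true else false.

(** The share of a current injected at [a] that reaches the old network at
    [x]. *)
Definition foot (a : RqG) (x : G) : R :=
  match a with
  | inl i => (x == i)%:R
  | inr (E, _) => (x \in val E)%:R / 2
  end.

Definition foot_mean (a : RqG) (f : G -> R) : R := \sum_x foot a x * f x.

Lemma foot_mean_old (i : G) (f : G -> R) : foot_mean (inl i) f = f i.
Proof. exact: sum_delta. Qed.

Lemma foot_mean_new (E : edge G) (k : 'I_q) (f : G -> R) :
  foot_mean (inr (E, k)) f = (\sum_(x in val E) f x) / 2.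
Proof.
rewrite big_mkcond mulr_suml; apply: eq_bigr => x _ /=.
by case: (x \in val E); rewrite ?mul0r // mul1r mulrC.
Qed.

Lemma card_edge (E : edge G) : #|val E| = 2.
Proof.
case: E => E /= /imset2P[u v _]; rewrite inE => uv ->.
by rewrite cards2; case: eqVneq uv => // ->; rewrite adj_irrefl.
Qed.

Lemma sum_foot (a : RqG) : \sum_x foot a x = 1.
Proof.
transitivity (foot_mean a (fun=> 1)).
  by apply: eq_bigr => x _; rewrite mulr1.
case: a => [i|[E k]]; first exact: foot_mean_old.
by rewrite foot_mean_new sumr_const card_edge divff // pnatr_eq0.
Qed.

Lemma neighbors_new (e : edge G * 'I_q) :
  @neighbors RqG (inr e) = inl @: val e.1.
Proof.
case: e => E k; apply/setP => -[x|e]; rewrite inE /=.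
  by rewrite mem_imset //; apply: inl_inj.
by apply/esym/negbTE/imsetP => -[].
Qed.

Lemma foot_mean_pair (e : edge G * 'I_q) (s t : G) (f : G -> R) :
  @neighbors RqG (inr e) = [set inl s; inl t] ->
  foot_mean (inr e) f = (f s + f t) / 2.
Proof.
case: e => E k; rewrite neighbors_new => NE.
have EE : val E = [set s; t].
  apply: (imset_inj (@inl_inj G (edge G * 'I_q))).
  by rewrite imsetU !imset_set1.
have st : s != t.
  by have := card_edge E; rewrite EE cards2; case: eqVneq.
by rewrite foot_mean_new EE sum_pair.
Qed.

(** In a simple graph, the edges at x correspond to the neighbors of x. *)
Lemma sum_incident_edges (x : G) (F : {set G} -> R) :
  \sum_(E : edge G | x \in val E) F (val E) =
  \sum_(y in neighbors x) F [set x; y].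
Proof.
have inj : {in neighbors x &, injective (fun y => [set x; y])}.
  move=> y z; rewrite !inE => xy xz /setP/(_ y).
  rewrite !inE eqxx orbT; case: eqVneq xy => [->|_ _ /esym/eqP //].
  by rewrite adj_irrefl.
rewrite -(big_imset _ inj) /=.
transitivity (\sum_(A in edges G | x \in A) F A).
  by rewrite [RHS]big_sub_cond.
apply: eq_bigl => A; apply/andP/imsetP.
  move=> [/imset2P[u v _]]; rewrite inE => uv -> /set2P[->|->].
    by exists v; rewrite ?inE.
  by exists u; rewrite ?inE 1?adj_sym // setUC.
move=> [y xy ->]; split; last by rewrite set21.
by apply/imset2P; exists x y.
Qed.

(** The potential of injected currents [h] in the triangulation graph, when [p]
    is a potential in G of the same currents moved to the feet. The factor
    2 / (q + 2) is the resistance of a unit edge in parallel with q paths of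
    resistance 2; the last term is the drop of the current [h a] through the
    two parallel unit edges of a new node. *)
Definition lift_potential (p : G -> R) (h : RqG -> R) (a : RqG) : R :=
  2 / (q%:R + 2) * foot_mean a p + (new_node a)%:R * h a / 2.

Lemma q2_neq0 : q%:R + 2 != 0 :> R.
Proof. by rewrite -natrD pnatr_eq0 addn2. Qed.

Lemma lift_potential_old p h (y : G) :
  lift_potential p h (inl y) = 2 / (q%:R + 2) * p y.
Proof. by rewrite /lift_potential foot_mean_old /= !mul0r addr0. Qed.

Lemma laplacian_lift_new p h (e : edge G * 'I_q) :
  laplacian (lift_potential p h) (inr e : RqG) = h (inr e).
Proof.
rewrite /laplacian neighbors_new big_imset; last by move=> ? ? _ _ [].
case: e => E k; rewrite sumrB sumr_const card_edge.
under eq_bigr do rewrite lift_potential_old.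
rewrite -mulr_sumr /lift_potential foot_mean_new mul1r; field; exact: q2_neq0.
Qed.

Lemma sum_triangulation (F : RqG -> R) :
  \sum_a F a = \sum_x F (inl x) + \sum_(E : edge G) \sum_k F (inr (E, k)).
Proof.
rewrite big_sumType pair_bigA /=; congr (_ + _).
by apply: eq_bigr => -[E k] _.
Qed.

Lemma laplacian_triangulation_old (P : RqG -> R) (x : G) :
  laplacian P (inl x) = \sum_(y in neighbors x) (P (inl x) - P (inl y))
    + \sum_(E : edge G | x \in val E) \sum_k (P (inl x) - P (inr (E, k))).
Proof.
rewrite /laplacian big_mkcond sum_triangulation; congr (_ + _).
  by rewrite [RHS]big_mkcond; apply: eq_bigr => y _; rewrite !inE.
rewrite [RHS]big_mkcond; apply: eq_bigr => E _.
under eq_bigr do rewrite inE.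
by rewrite /=; case: ifP => // _; rewrite big1.
Qed.

(** The currents to old neighbors add up to c times laplacian p x, with
    c = 2 / (q + 2). The middle nodes above an edge xy lie, when h vanishes, at
    the midpoint of its ends and so take q c / 2 times the current of p along
    xy; together this is laplacian p x, because c (1 + q / 2) = 1. The raise
    of the middle nodes by h / 2 removes exactly the shares of their currents
    contained in laplacian p x, leaving h at x. *)
Lemma laplacian_lift_old p h (x : G) :
  laplacian p x = \sum_a h a * foot a x ->
  laplacian (lift_potential p h) (inl x : RqG) = h (inl x).
Proof.
move=> Hp; rewrite laplacian_triangulation_old.
have -> : \sum_(y in neighbors x)
    (lift_potential p h (inl x) - lift_potential p h (inl y))
    = 2 / (q%:R + 2) * laplacian p x.
  by rewrite mulr_sumr; apply: eq_bigr => y _; rewrite !lift_potential_old mulrBr.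
(* Averaging over the two ends of an edge halves its potential drop. *)
have mid : \sum_(E : edge G | x \in val E) (p x - (\sum_(y in val E) p y) / 2)
    = laplacian p x / 2.
  rewrite (sum_incident_edges _ (fun A => p x - (\sum_(y in A) p y) / 2)).
  rewrite mulr_suml; apply: eq_bigr => y; rewrite inE => xy.
  have xNy : x != y by case: eqVneq xy => // ->; rewrite adj_irrefl.
  by rewrite sum_pair //; field.
have -> : \sum_(E : edge G | x \in val E) \sum_k
    (lift_potential p h (inl x) - lift_potential p h (inr (E, k)))
  = q%:R * (2 / (q%:R + 2)) * (laplacian p x / 2)
    - (laplacian p x - h (inl x)).
  (* The part of laplacian p x that stems from currents injected at new nodes. *)
  have -> : laplacian p x - h (inl x) =
      \sum_(E : edge G | x \in val E) \sum_k h (inr (E, k)) / 2.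
    rewrite Hp sum_triangulation /=.
    have -> : \sum_i h (inl i) * (x == i)%:R = h (inl x).
      under eq_bigr do rewrite mulrC eq_sym.
      exact: (sum_delta x (fun y => h (inl y))).
    rewrite addrC addKr [RHS]big_mkcond.
    apply: eq_bigr => E _; case: (x \in val E).
      by apply: eq_bigr => k _; rewrite mul1r.
    by rewrite big1 // => k _; rewrite mul0r mulr0.
  rewrite -mid mulr_sumr -sumrB; apply: eq_bigr => E xE.
  rewrite -mulrA mulr_natl -[X in _ *+ X](card_ord q) -sumr_const -sumrB.
  apply: eq_bigr => k _.
  by rewrite lift_potential_old /lift_potential foot_mean_new /=; ring.
field; exact: q2_neq0.
Qed.

Lemma laplacian_lift p h :
  (forall x, laplacian p x = \sum_a h a * foot a x) ->
  forall a, laplacian (lift_potential p h) a = h a.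
Proof.
by move=> Hp [x|e]; [apply: laplacian_lift_old | apply: laplacian_lift_new].
Qed.

(** * Resistances in the triangulation graph *)

Definition foot_resistance (a b : RqG) : R :=
  foot_mean a (fun x => foot_mean b (fun y => resistance R x y)).

Hypothesis G_connected : connected_graph G.

Lemma foot_resistance_sym a b : foot_resistance a b = foot_resistance b a.
Proof.
rewrite /foot_resistance /foot_mean; under eq_bigr do rewrite mulr_sumr.
under [RHS]eq_bigr do rewrite mulr_sumr.
rewrite exchange_big; apply: eq_bigr => y _; apply: eq_bigr => x _.
by rewrite (resistance_sym R G_connected x y) mulrCA.
Qed.

Lemma foot_meanB a b f :
  \sum_x (foot a x - foot b x) * f x = foot_mean a f - foot_mean b f.
Proof. by rewrite -sumrB; apply: eq_bigr => x _; rewrite mulrBl. Qed.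

(** The unit current from [a] to [b] has the energy of the currents
    foot a - foot b in G, scaled by 2 / (q + 2), plus 1/2 at each end that is
    new. Expanding the quadratic form of [energy_resistance] at foot a - foot b
    gives the three [foot_resistance] terms; those with equal arguments do not
    vanish at a new node, whose feet are distinct. The factor [a != b] accounts
    for the injected currents cancelling when [a] and [b] coincide. *)
Lemma triangulation_resistance (a b : RqG) :
  resistance R a b =
    (a != b)%:R * ((new_node a)%:R + (new_node b)%:R) / 2
    + (2 * foot_resistance a b - foot_resistance a a - foot_resistance b b)
      / (q%:R + 2).
Proof.
pose h (c : RqG) : R := (c == a)%:R - (c == b)%:R.
have [p Hp] : exists p, forall x, laplacian p x = foot a x - foot b x.
  by apply: poisson_solvable => //; rewrite sumrB !sum_foot subrr.
have Hlift : unit_current_potential a b (lift_potential p h).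
  apply: laplacian_lift => x.
  by rewrite Hp (sum_dipole a b (fun c => foot c x)).
rewrite (resistance_eq Hlift) /lift_potential.
have energy : foot_mean a p - foot_mean b p =
    - 2^-1 * (foot_resistance a a + foot_resistance b b
              - 2 * foot_resistance a b).
  transitivity (\sum_x laplacian p x * p x).
    by rewrite -foot_meanB; apply: eq_bigr => x _; rewrite Hp.
  rewrite energy_resistance //; congr (_ * _).
  under eq_bigr => x _.
    under eq_bigr do rewrite Hp.
    rewrite Hp foot_meanB mulrBr.
    over.
  rewrite sumrB !foot_meanB -!/(foot_resistance _ _).
  by rewrite (foot_resistance_sym b a); ring.
have sources : (new_node a)%:R * h a - (new_node b)%:R * h b =
    (a != b)%:R * ((new_node a)%:R + (new_node b)%:R).
  rewrite /h !eqxx (eq_sym b a); case: eqVneq => [->|_] /=; ring.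
transitivity (2 / (q%:R + 2) * (foot_mean a p - foot_mean b p)
  + ((new_node a)%:R * h a - (new_node b)%:R * h b) / 2); first by ring.
rewrite energy sources; field; exact: q2_neq0.
Qed.

End Triangulation.

Theorem theorem5 (R : realFieldType) (G : sgraph) (q : nat)
    (G_connected : connected_graph G) (q_gt0 : (0 < q)%N) :
  let RqG := triangulation G q in
  let r : G -> G -> R := @resistance R G in
  let r' : RqG -> RqG -> R := @resistance R RqG in
  [/\ forall i j : G,
        r' (inl i) (inl j) = 2 / (q%:R + 2) * r i j,
      forall (i : edge G * 'I_q) (j s t : G),
        @neighbors RqG (inr i) = [set inl s; inl t] ->
        r' (inr i) (inl j)
          = 1 / 2 + (2 * r s j + 2 * r t j - r s t) / (2 * (q%:R + 2))
    & forall (i j : edge G * 'I_q) (s t u v : G),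
        i <> j ->
        @neighbors RqG (inr i) = [set inl s; inl t] ->
        @neighbors RqG (inr j) = [set inl u; inl v] ->
        r' (inr i) (inr j)
          = 1 + (r s u + r t u + r s v + r t v - r u v - r s t)
                / (2 * (q%:R + 2))].
Proof.
move=> RqG r r'.
have r0 x : r x x = 0 by apply: resistance_refl.
have rC x y : r x y = r y x by apply: resistance_sym.
split=> [i j|i j s t Ni|i j s t u v /eqP ij Ni Nj];
  rewrite /r' triangulation_resistance // /foot_resistance;
  rewrite ?(foot_mean_pair _ Ni) ?(foot_mean_pair _ Nj) ?foot_mean_old;
  rewrite -!/(r _ _) !r0 /=.
- field; exact: q2_neq0.
- rewrite (rC t s); field; exact: q2_neq0.
- have -> : (inr i != inr j :> RqG) = (i != j) by [].
  rewrite ij (rC t s) (rC v u) /=; field; exact: q2_neq0.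
Qed.
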